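(* Let $q\in\mathbb{C}$ with $0<|q|<1$, let $\lambda\in\mathbb{R}$ and $\xi\in\mathbb{C}\setminus\{0\}$. Let $b_1,\dots,b_N$ be mutually distinct non-zero complex numbers, $b_0=0$, and let $B_\infty,B_1,\dots,B_N$ be complex $m\times m$ matrices. Let $Y(x)$ be a $\mathbb{C}^m$-valued solution of $$Y(qx)=\Big(B_\infty+\sum_{i=1}^N\frac{B_i}{1-x/b_i}\Big)Y(x),$$ and write $[Y(s)]_k$ for the $k$-th component of $Y(s)$. Assume: (a) there exist $\varepsilon_1,C_1\in\mathbb{R}_{>0}$ and $M_1\in\mathbb{Z}$ such that $|[Y(s)]_k|\le C_1|s|^{\varepsilon_1}$ for every $s\in\{q^n\xi\mid n\ge M_1,\ n\in\mathbb{Z}\}$ and $k=1,\dots,m$; (b) there exist $\varepsilon_2,C_2\in\mathbb{R}_{>0}$ and $M_2\in\mathbb{Z}$ such that $|[Y(s)]_k|\le C_2|s|^{\lambda-\varepsilon_2}$ for every $s\in\{q^n\xi\mid n\le M_2,\ n\in\mathbb{Z}\}$ and $k=1,\dots,m$. Then the function $\widehat{Y}(x)$ defined by $$\widehat{Y}_i(x)=\int_0^{\xi\infty}\frac{P_\lambda(x,s)}{s-b_i}Y(s)\,d_qs\quad(i=0,\dots,N),\qquad \widehat{Y}(x)=\begin{pmatrix}\widehat{Y}_0(x)\\ \vdots\\ \widehat{Y}_N(x)\end{pmatrix}$$ is convergent and satisfies $$\widehat{Y}(qx)=\Big(F_\infty+\sum_{i=1}^N\frac{F_i}{1-x/b_i}\Big)\widehat{Y}(x),$$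 where $(F_\infty;F_1,\dots,F_N)=c_\lambda(B_\infty;B_1,\dots,B_N)$ is the $q$-convolution.
   Context: Notation: $(a;q)_\infty=\prod_{j\ge 0}(1-q^ja)$ and $$P_\lambda(x,s)=\frac{(q^{\lambda+1}s/x;q)_\infty}{(qs/x;q)_\infty}.$$ A branch of $\log q$ is fixed and $q^a=e^{a\log q}$. Jackson integral: $\int_0^{\xi\infty}f(s)\,d_qs=(1-q)\sum_{n=-\infty}^{\infty}q^n\xi f(q^n\xi)$. $q$-convolution: given $m\times m$ matrices $(B_\infty;B_1,\dots,B_N)$, put $B_0=I_m-B_\infty-B_1-\dots-B_N$. Then $c_\lambda(B_\infty;B_1,\dots,B_N)=(F_\infty;F_1,\dots,F_N)$ is the tuple of $(N+1)m\times(N+1)m$ matrices, written in $m\times m$ blocks with block indices $0,1,\dots,N$, defined as follows. For $1\le i\le N$, all block rows of $F_i$ are zero except the block row with index $i$ (the $(i+1)$-st), which is $(B_0,\dots,B_{i-1},\,B_i-(1-q^\lambda)I_m,\,B_{i+1},\dots,B_N)$. Moreover $F_\infty=I_{(N+1)m}-\widehat{F}$, where every block row of $\widehat{F}$ equals $(B_0,B_1,\dots,B_N)$. Convention: $\xi$ and $x$ are such that no denominator vanishes in the expressions involved (i.e. $q^n\xi\ne b_i$ for $n\in\mathbb{Z}$, $1\le i\le N$; $x\neq 0$, $x\notin\xi q^{\mathbb{Z}}$; $x\ne b_i$). *)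

(* Defs.v *)
From HB Require Import structures.
From mathcomp Require Import all_boot all_order all_algebra.
From mathcomp Require Import all_classical all_reals all_analysis.
From mathcomp Require Import complex.
Set Implicit Arguments. Unset Strict Implicit. Unset Printing Implicit Defensive.
Import Order.TTheory GRing.Theory Num.Theory.
Import numFieldNormedType.Exports.
Local Open Scope classical_set_scope.
Local Open Scope ring_scope.
Local Open Scope complex_scope.

(* Giving the type [R[i]] as a [numClosedFieldType] lets it inherit the
   topology of the modulus from [numFieldNormedType]. *)
Definition Cplx (R : realType) : numClosedFieldType := R[i].

Section Defs.
Context {R : realType}.
Local Notation C := (Cplx R).

(* The modulus as an element of [R]; [`|z|] itself lives in [R[i]]. *)
Definition cmod (z : C) : R := complex.Re `|z|.

Definition cexp (z : C) : C :=
  (expR (complex.Re z))%:C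
  * (cos (complex.Im z) +i* sin (complex.Im z) : R[i]).

(* [q ^ a = e ^ (a * log q)], where [logq] is the chosen value of [log q]. *)
Definition qpow (logq : C) (a : R) : C := cexp ((a%:C : C) * logq).

Definition qpoch (q a : C) : C :=
  lim ((\prod_(0 <= j < n) (1 - q ^+ j * a)) @[n --> \oo]).

Definition qP (q logq : C) (lam : R) (x s : C) : C :=
  qpoch q (qpow logq (lam + 1) * s / x) / qpoch q (q * s / x).

Section Jackson.
Variables (q xi : C) (f : C -> C).

Definition jackson_term (n : int) : C := q ^ n * xi * f (q ^ n * xi).

(* A series over all integers converges when both of its halves do. *)
Definition jackson_pos : C ^nat := series (fun n : nat => jackson_term n%:Z).
Definition jackson_neg : C ^nat :=
  series (fun n : nat => jackson_term (- (n.+1)%:Z)).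

Definition jackson_cvg : Prop :=
  cvg (jackson_pos @ \oo) /\ cvg (jackson_neg @ \oo).

Definition jackson : C :=
  (1 - q) * (lim (jackson_pos @ \oo) + lim (jackson_neg @ \oo)).
End Jackson.

(* Families [a_1, ..., a_N] are functions on ['I_N], the ordinal [i] standing
   for the index [i + 1]; [ext0 a0 a] is the family [a_0, a_1, ..., a_N]. *)
Definition ext0 {T : Type} {N : nat} (a0 : T) (a : 'I_N -> T) (j : 'I_N.+1) : T :=
  oapp a a0 (unlift ord0 j).

Definition qdiff_coef {n N : nat} (b : 'I_N -> C)
    (Binf : 'M[C]_n) (B : 'I_N -> 'M[C]_n) (x : C) : 'M[C]_n :=
  Binf + \sum_(i < N) (1 - x / b i)^-1 *: B i.

(* The equation is only meaningful away from its poles [b i]. *)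
Definition qdiff_solution {n N : nat} (q : C) (b : 'I_N -> C)
    (Binf : 'M[C]_n) (B : 'I_N -> 'M[C]_n) (D : set C) (Y : C -> 'cV[C]_n) :
    Prop :=
  forall x : C, D x -> (forall i, x != b i) ->
    Y (q * x) = qdiff_coef b Binf B x *m Y x.

Section Convolution.
Variables (m N : nat) (logq : C) (lam : R).
Variables (Binf : 'M[C]_m) (B : 'I_N -> 'M[C]_m).

Definition conv_B : 'I_N.+1 -> 'M[C]_m :=
  ext0 (1%:M - Binf - \sum_(i < N) B i) B.

(* The size [\sum_(k < N.+1) m] is [(N + 1) * m], in the form required by
   [\mxblock]. *)
Definition conv_F (i : 'I_N) : 'M[C]_(\sum_(k < N.+1) m) :=
  \mxblock_(k < N.+1, l < N.+1)
    (if k == lift ord0 i then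
       if l == lift ord0 i then conv_B l - (1 - qpow logq lam)%:M else conv_B l
     else 0).

Definition conv_Finf : 'M[C]_(\sum_(k < N.+1) m) :=
  1%:M - \mxblock_(k < N.+1, l < N.+1) conv_B l.
End Convolution.

Section Transform.
Variables (m N : nat) (q logq : C) (lam : R) (xi : C).
Variables (b : 'I_N -> C) (Y : C -> 'cV[C]_m).

Definition Yhat_integrand (i : 'I_N.+1) (k : 'I_m) (x s : C) : C :=
  qP q logq lam x s / (s - ext0 0 b i) * Y s k ord0.

Definition Yhat_block (i : 'I_N.+1) (x : C) : 'cV[C]_m :=
  \col_(k < m) jackson q xi (Yhat_integrand i k x).

Definition Yhat (x : C) : 'cV[C]_(\sum_(i < N.+1) m) :=
  \mxcol_(i < N.+1) Yhat_block i x.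
End Transform.

Definition off_spiral (q xi : C) : set C :=
  [set x : C | x != 0 /\ forall n : int, x != q ^ n * xi].

End Defs.

(* Main.v *)
Require Import Defs.
From mathcomp Require Import all_boot all_order all_algebra.
From mathcomp Require Import all_classical all_reals all_analysis.
From mathcomp Require Import complex.
From mathcomp Require Import ring lra zify.
Import Order.TTheory GRing.Theory Num.Theory.
Import numFieldNormedType.Exports.
Local Open Scope classical_set_scope.
Local Open Scope ring_scope.

(** Write [s] for a point [q ^ n * xi] of the spiral, [p] for the kernel
    [P_lambda(x, s)], [p'] for [P_lambda(q x, s)] and [a] for [q ^ lambda].

    Two facts about the kernel suffice.  Since a q-Pochhammer symbol satisfies
    [(z; q) = (1 - z) (q z; q)], the kernel satisfies
    [P_lambda(q x, s) = P_lambda(x, s / q) = (x - a s) / (x - s) * p]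
    ([qP_scale], [qP_dilate]).  The same recurrence bounds its growth along the
    spiral: the ratio of consecutive values tends to 1 for [s -> 0] and to [a]
    for [s -> oo], with a geometric error, so that the kernel is [O(1)] at 0 and [O(|s| ^ - lambda)] at infinity ([qP_geom_pos],
    [qP_geom_neg], both from [geom_bounded_growth]).  Together with the growth
    assumptions on [Y], every bilateral series below is dominated by a
    geometric one at both ends, which gives convergence.

    For the functional equation, the q-difference equation of [Y] amounts to
    [sum_j s B_j Y(s) / (s - b_j) = Y(s) - Y(q s)] ([conv_B_coef]), so that
    [S = sum_j B_j Yhat_j(x)] is the bilateral sum of [p (Y(s) - Y(q s))].
    Up to the telescoping difference of [P_lambda(x, s / q) Y(s)], whose sum is 0
    because this quantity vanishes at both ends, the summand is [(p - p') Y(s)]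
    with [p - p' = - (1 - a) s / (x - s) * p].  The claim for the block [i] of
    [Yhat(q x)] then holds term by term, by a partial fraction decomposition of
    [s / ((x - s) (s - b_i))] ([term_dilate]), and it is summed by
    linearity ([bisum_term_dilate]). *)

(** * Complex sequences bounded by geometric ones *)

Section ComplexSequences.
Context {R : realType}.
Local Notation C := (Cplx R).
Implicit Types (f g : C ^nat) (u v : R ^nat).

Lemma normE (z : C) : `|z| = real_complex R (cmod z).
Proof. by rewrite /cmod RRe_real // normr_real. Qed.

Lemma cmod_ge0 (z : C) : 0 <= cmod z.
Proof. by rewrite -lecR -normE normr_ge0. Qed.

Lemma cmodM (z w : C) : cmod (z * w) = cmod z * cmod w.
Proof. by apply: complexI; rewrite rmorphM -!normE normrM. Qed.

Lemma cmodV (z : C) : cmod z^-1 = (cmod z)^-1.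
Proof. by apply: complexI; rewrite fmorphV -!normE normfV. Qed.

Lemma cmodX (z : C) n : cmod (z ^+ n) = cmod z ^+ n.
Proof. by apply: complexI; rewrite rmorphXn -!normE normrX. Qed.

Lemma cmodN (z : C) : cmod (- z) = cmod z.
Proof. by rewrite /cmod normrN. Qed.

Lemma cmod1 : cmod (1 : C) = 1.
Proof. by rewrite /cmod normr1. Qed.

Lemma cmodD (z w : C) : cmod (z + w) <= cmod z + cmod w.
Proof. by rewrite -lecR rmorphD -!normE ler_normD. Qed.

Lemma cmod_eq0 (z : C) : (cmod z == 0) = (z == 0).
Proof. by rewrite -(inj_eq (@complexI R)) -normE rmorph0 normr_eq0. Qed.

Lemma cmod_gt0 (z : C) : (0 < cmod z) = (z != 0).
Proof. by rewrite lt_def cmod_eq0 cmod_ge0 andbT. Qed.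

Lemma ler_cmodB (z w : C) : cmod z - cmod w <= cmod (z - w).
Proof. by rewrite lerBlDr; have := cmodD (z - w) w; rewrite subrK. Qed.

Lemma cmod_lt1 (q : C) : `|q| < 1 -> 0 <= cmod q < 1.
Proof. by move=> q1; rewrite cmod_ge0 -ltcR -normE rmorph1. Qed.

Lemma Re_le_cmod (z : C) : `|complex.Re z| <= cmod z.
Proof. by rewrite -lecR -normE; exact: normc_ge_Re. Qed.

Lemma Im_le_cmod (z : C) : `|complex.Im z| <= cmod z.
Proof.
have := Re_le_cmod (z * (Complex 0 1)).
rewrite cmodM; case: z => a b /=; rewrite mulr0 mulr1 sub0r normrN.
suff -> : cmod (Complex 0 1 : C) = 1 by rewrite mulr1.
by rewrite /cmod normc_def /= expr0n expr1n add0r sqrtr1.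
Qed.

Lemma cmod_le_ReIm (z : C) : cmod z <= `|complex.Re z| + `|complex.Im z|.
Proof.
rewrite /cmod normc_def /= -[leRHS]ger0_norm ?addr_ge0 // -sqrtr_sqr ler_wsqrtr //.
rewrite sqrrD !real_normK ?num_real //.
by rewrite lerD2r lerDl mulrn_wge0 // mulr_ge0.
Qed.

(** Completeness of the complex numbers is reduced to that of the reals through
    this lemma, applied to the partial sums of a series. *)
Lemma cvg_ReIm f (l : C) :
  complex.Re (f n) @[n --> \oo] --> complex.Re l ->
  complex.Im (f n) @[n --> \oo] --> complex.Im l ->
  f @ \oo --> l.
Proof.
move=> /cvgrPdist_lt hRe /cvgrPdist_lt hIm; apply/cvgrPdist_lt => e e0.
have [e' e'E] : exists e' : R, e = real_complex R e'.
  by exists (complex.Re e); rewrite RRe_real // gtr0_real.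
rewrite e'E in e0 *; have {}e0 : 0 < e' by rewrite -ltcR.
have e2 : 0 < e' / 2 by rewrite divr_gt0.
near=> n; rewrite normE ltcR; apply: le_lt_trans (cmod_le_ReIm _) _.
rewrite (splitr e'); apply: ltrD.
  have : `|complex.Re l - complex.Re (f n)| < e' / 2 by near: n; exact: hRe.
  by case: (l) (f n) => [a b] [c d].
have : `|complex.Im l - complex.Im (f n)| < e' / 2 by near: n; exact: hIm.
by case: (l) (f n) => [a b] [c d].
Unshelve. all: by end_near. Qed.

Lemma Re_series f n : complex.Re (series f n) = series (fun k => complex.Re (f k)) n.
Proof.
elim: n => [|n IH]; first by rewrite /series /= !big_geq.
by rewrite !seriesSr -IH; case: (series f n) (f n) => [a b] [c d].
Qed.

Lemma Im_series f n : complex.Im (series f n) = series (fun k => complex.Im (f k)) n.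
Proof.
elim: n => [|n IH]; first by rewrite /series /= !big_geq.
by rewrite !seriesSr -IH; case: (series f n) (f n) => [a b] [c d].
Qed.

(** Rates multiply under products, rate 1 means boundedness, and a rate below 1
    gives a convergent series. *)
Definition geom_bounded f (r : R) : Prop :=
  exists K : R, \forall n \near \oo, cmod (f n) <= K * r ^+ n.

Lemma geom_boundedM f g (r1 r2 : R) : geom_bounded f r1 -> geom_bounded g r2 ->
  geom_bounded (fun n => f n * g n) (r1 * r2).
Proof.
move=> [K1 h1] [K2 h2]; exists (K1 * K2); near=> n.
rewrite cmodM exprMn mulrACA; apply: ler_pM; rewrite ?cmod_ge0 //; near: n; assumption.
Unshelve. all: by end_near. Qed.

Lemma real_series_cvg_geometric u (K r : R) : 0 <= r < 1 ->
  (\forall n \near \oo, `|u n| <= K * r ^+ n) -> cvg (series u @ \oo).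
Proof.
move=> /andP[r0 r1] [n0 _ hn0].
have hs : cvgn (series (geometric (K * r ^+ n0) r)).
  by apply: is_cvg_geometric_series; rewrite ger0_norm.
have h n : `|u (n + n0)%N| <= geometric (K * r ^+ n0) r n.
  by rewrite /geometric /= -mulrA -exprD addnC; apply: hn0; rewrite /= leq_addr.
have : cvgn (series (fun n => u (n + n0)%N)).
  apply: normed_cvg; apply: series_le_cvg hs => // n; first exact: normr_ge0.
  exact: le_trans (h n).
move=> /cvg_ex[l hl]; apply/cvg_ex; exists (series u n0 + l).
rewrite -(cvg_shiftn n0).
have -> : [sequence series u (n + n0)%N]_n =
    (fun n => series u n0 + series (fun k => u (k + n0)%N) n).
  apply/funext => n; rewrite /= series_addn; congr (_ + _).
  by rewrite -{1}[n0]add0n big_addn addnK.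
by apply: cvgD hl; exact: cvg_cst.
Qed.

Lemma series_cvg_geometric f (r : R) : 0 <= r < 1 ->
  geom_bounded f r -> cvg (series f @ \oo).
Proof.
move=> r01 [K hK].
have hRe : cvgn (series (fun n => complex.Re (f n))).
  apply: (real_series_cvg_geometric _ K _ r01).
  by near=> n; apply: le_trans (Re_le_cmod _) _; near: n.
have hIm : cvgn (series (fun n => complex.Im (f n))).
  apply: (real_series_cvg_geometric _ K _ r01).
  by near=> n; apply: le_trans (Im_le_cmod _) _; near: n.
apply/cvg_ex; exists (Complex (limn (series (fun n => complex.Re (f n))))
                   (limn (series (fun n => complex.Im (f n)))) : C).
apply: cvg_ReIm.
  by under eq_fun do rewrite Re_series; exact: hRe.
by under eq_fun do rewrite Im_series; exact: hIm.
Unshelve. all: by end_near. Qed.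

Lemma cvg0_geometric f (r : R) : 0 <= r < 1 ->
  geom_bounded f r -> f @ \oo --> (0 : C).
Proof.
by move=> r01 hf; apply: cvg_series_cvg_0; exact: series_cvg_geometric hf.
Qed.

(** A multiplicative error [1 + K r ^ n] per step costs only a constant factor,
    since the product of these errors converges. *)
Lemma geom_bounded_growth f (w r K : R) : 0 < w -> 0 <= r < 1 -> 0 <= K ->
  (\forall n \near \oo, cmod (f n.+1) <= w * (1 + K * r ^+ n) * cmod (f n)) ->
  geom_bounded f w.
Proof.
move=> w0 /andP[r0 r1] K0 [n0 _ hf].
have r10 : 0 < 1 - r by rewrite subr_gt0.
(* [K r ^ n / (1 - r)] is the sum of [K r ^ k] over [k >= n]: the exponential
   bounds the product of the errors still to come, so [v] is nonincreasing. *)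
pose v n := cmod (f n) * w ^- n * expR (K * r ^+ n / (1 - r)).
have wn n : 0 < w ^+ n by rewrite exprn_gt0.
have v_decr n : (n0 <= n)%N -> v n.+1 <= v n.
  move=> /hf hn; rewrite /v.
  have -> : K * r ^+ n / (1 - r) = K * r ^+ n + K * r ^+ n.+1 / (1 - r).
    by rewrite exprS; field; rewrite gt_eqF.
  rewrite expRD [leRHS]mulrA ler_pM2r ?expR_gt0 //.
  rewrite ler_pdivrMr //; apply: le_trans hn _.
  have -> : cmod (f n) / w ^+ n * expR (K * r ^+ n) * w ^+ n.+1 =
      w * expR (K * r ^+ n) * cmod (f n).
    by rewrite exprS; field; rewrite gt_eqF.
  by rewrite ler_wpM2r ?cmod_ge0 // ler_wpM2l ?(ltW w0) // expR_ge1Dx.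
have v_le k : v (n0 + k)%N <= v n0.
  elim: k => [|k IH]; first by rewrite addn0.
  by rewrite addnS; apply: le_trans IH; apply: v_decr; rewrite leq_addr.
exists (v n0), n0 => // n /= n0n.
have := v_le (n - n0)%N; rewrite subnKC // => {v_le v_decr}hv.
rewrite -ler_pdivrMr //; apply: le_trans hv; rewrite /v ler_peMr //.
  by rewrite mulr_ge0 ?cmod_ge0 // invr_ge0 ltW.
have := expR_ge1Dx (K * r ^+ n / (1 - r)); apply: le_trans.
by rewrite lerDl mulr_ge0 // ?invr_ge0 ?(ltW r10) // mulr_ge0 // exprn_ge0.
Qed.

(** All ratios met along the spiral, for the kernel as well as [s / (s - b)], are
    Moebius functions of [q ^ n] taking the value 1 at 0, up to a constant or
    bounded factor. *)
Lemma mobius_growth (c d q : C) : `|q| < 1 ->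
  exists K : R, 0 <= K /\ \forall n \near \oo,
    cmod ((1 - c * q ^+ n) / (1 - d * q ^+ n)) <= 1 + K * cmod q ^+ n.
Proof.
move=> /cmod_lt1 q1.
exists (2 * cmod (d - c)); split; first by rewrite mulr_ge0 ?cmod_ge0.
have : geometric (cmod d) (cmod q) @ \oo --> (0 : R).
  by apply: cvg_geometric; rewrite ger0_norm; case/andP: q1.
move=> /cvgrPdist_lt/(_ (2^-1)) h.
have {}h : \forall n \near \oo, cmod d * cmod q ^+ n < 2^-1.
  have := h ltac:(by rewrite invr_gt0); apply: filterS => n.
  by rewrite sub0r normrN ger0_norm // mulr_ge0 ?exprn_ge0 ?cmod_ge0.
near=> n.
have hn : cmod d * cmod q ^+ n < 2^-1 by near: n.
have hd : 2^-1 <= cmod (1 - d * q ^+ n).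
  have := ler_cmodB 1 (d * q ^+ n); rewrite cmod1 cmodM cmodX; lra.
have d0 : 1 - d * q ^+ n != 0 by rewrite -cmod_gt0; apply: lt_le_trans hd.
have -> : (1 - c * q ^+ n) / (1 - d * q ^+ n) =
    1 + (d - c) * q ^+ n / (1 - d * q ^+ n) by field.
apply: le_trans (cmodD _ _) _; rewrite cmod1 lerD2l.
rewrite !cmodM cmodV cmodX mulrC mulrA ler_wpM2r ?exprn_ge0 ?cmod_ge0 //.
rewrite ler_wpM2r ?cmod_ge0 // invf_ple ?posrE ?invr_gt0 //.
by rewrite cmod_gt0.
Unshelve. all: by end_near. Qed.

Lemma mobius_bounded (c d q : C) : `|q| < 1 ->
  geom_bounded (fun n => (1 - c * q ^+ n) / (1 - d * q ^+ n)) 1.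
Proof.
move=> q1; have [K [K0 hK]] := mobius_growth c d _ q1; exists (1 + K).
near=> n; rewrite expr1n mulr1.
have hn : cmod ((1 - c * q ^+ n) / (1 - d * q ^+ n)) <= 1 + K * cmod q ^+ n.
  by near: n.
apply: le_trans hn _; rewrite lerD2l ler_piMr // exprn_ile1 ?cmod_ge0 //.
by case/andP: (cmod_lt1 _ q1) => _ /ltW.
Unshelve. all: by end_near. Qed.

End ComplexSequences.

(** * The kernel along the spiral *)

Section QPower.
Context {R : realType}.
Local Notation C := (Cplx R).

Lemma cexpD (z w : C) : cexp (z + w) = cexp z * cexp w.
Proof.
case: z w => [a b] [c d]; rewrite /cexp /= expRD cosD sinD rmorphM mulrACA.
by congr (_ * _); apply/eqP; rewrite eq_complex /= eqxx /= addrC.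
Qed.

Lemma cmod_cexp (z : C) : cmod (cexp z) = expR (complex.Re z).
Proof.
case: z => a b; rewrite /cexp /= cmodM.
rewrite {2}/cmod normc_def /= cos2Dsin2 sqrtr1 mulr1.
by rewrite /cmod normc_def /= expr0n addr0 sqrtr_sqr ger0_norm ?expR_ge0.
Qed.

Lemma qpowD (logq : C) (a b : R) : qpow logq (a + b) = qpow logq a * qpow logq b.
Proof. by rewrite /qpow rmorphD mulrDl cexpD. Qed.

Lemma qpow1 (logq : C) : qpow logq 1 = cexp logq.
Proof. by rewrite /qpow rmorph1 mul1r. Qed.

Lemma cmod_qpow (logq : C) (a : R) : cmod (qpow logq a) = cmod (cexp logq) `^ a.
Proof.
rewrite /qpow !cmod_cexp -expRM; congr expR.
by case: logq => c d /=; rewrite mul0r subr0 mulrC.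
Qed.

Lemma qpow_neq0 (logq : C) (a : R) : qpow logq a != 0.
Proof. by rewrite -cmod_gt0 cmod_cexp expR_gt0. Qed.

End QPower.

Section Kernel.
Context {R : realType}.
Local Notation C := (Cplx R).
Variables (q logq : C) (lam : R).
Hypotheses (hq0 : q != 0) (hq1 : `|q| < 1) (hlogq : cexp logq = q).

(** The partial products are bounded, hence their increments
    [- q ^ n a p_n] are summable. *)
Lemma qpoch_cvg (a : C) :
  cvg ((\prod_(0 <= j < n) (1 - q ^+ j * a)) @[n --> \oo]).
Proof.
set p := fun n : nat => \prod_(0 <= j < n) (1 - q ^+ j * a) : C.
have pS n : p n.+1 = p n * (1 - q ^+ n * a) by rewrite /p big_nat_recr.
clearbody p.
have hp : geom_bounded p 1.
  apply: (geom_bounded_growth _ _ (cmod q) (cmod a)) => //.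
  - exact: cmod_lt1.
  - exact: cmod_ge0.
  near=> n; rewrite pS cmodM mul1r mulrC ler_wpM2r ?cmod_ge0 //.
  by rewrite (le_trans (cmodD _ _)) // cmod1 cmodN cmodM cmodX mulrC.
have ht : geom_bounded (telescope p) (cmod q).
  have -> : telescope p = (fun n => p n * (- a * q ^+ n)).
    by apply/funext => n; rewrite /telescope /= pS; ring.
  rewrite -[cmod q]mul1r; apply: geom_boundedM hp _.
  by exists (cmod a); near=> n; rewrite cmodM cmodN cmodX.
have := series_cvg_geometric _ _ (cmod_lt1 _ hq1) ht.
rewrite telescopeK => /cvg_ex[l hl]; apply/cvg_ex; exists (l + p 0%N).
have h : (fun n => (p n - p 0%N) + p 0%N) @ \oo --> l + p 0%N.
  by apply: cvgD; [exact: hl | exact: cvg_cst].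
by move: h; under eq_fun do rewrite subrK.
Unshelve. all: by end_near. Qed.

Lemma qpoch_rec (a : C) : qpoch q a = (1 - a) * qpoch q (q * a).
Proof.
have h := qpoch_cvg (q * a).
rewrite /qpoch; apply: cvg_lim; first exact: norm_hausdorff.
rewrite -cvg_shiftS /=.
under eq_fun => n.
  rewrite big_nat_recl // expr0 mul1r.
  under eq_bigr => j _ do rewrite exprSr -mulrA.
  over.
by apply: cvgM; [exact: cvg_cst | exact: h].
Qed.

(** It holds for all [x] and [s], poles included, since the inverse of a product
    is the product of the inverses even when a factor is 0. *)
Lemma qP_rec (x s : C) :
  qP q logq lam x s =
  (1 - qpow logq lam * (q * s) / x) / (1 - q * s / x) * qP q logq lam x (q * s).
Proof.
rewrite /qP qpoch_rec [qpoch q (q * s / x)]qpoch_rec.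
rewrite invfM mulrACA qpowD qpow1 hlogq; move: (qpow logq lam) => a.
by congr (_ / _ * (qpoch _ _ / qpoch _ _)); rewrite !mulrA // [q * a]mulrC.
Qed.

Lemma qP_scale (x s : C) : qP q logq lam (q * x) (q * s) = qP q logq lam x s.
Proof.
have h y : y * (q * s) / (q * x) = y * s / x.
  by rewrite mulrCA -mulf_div divff // mul1r.
by rewrite /qP !h.
Qed.

(** Going towards 0 needs the numerator of the ratio to be nonzero as well: if
    [x = q ^ (lambda + 1) s], the kernel vanishes at [s]. *)
Lemma qP_rec_inv (x s : C) : x != 0 -> x != q * s ->
  x != qpow logq lam * (q * s) ->
  qP q logq lam x (q * s) =
  (1 - q * s / x) / (1 - qpow logq lam * (q * s) / x) * qP q logq lam x s.
Proof.
have ne y : x != 0 -> x != y -> 1 - y / x != 0.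
  move=> x0 xy; rewrite -(divff x0) -mulrBl.
  by rewrite mulf_neq0 ?invr_eq0 // subr_eq0.
move=> x0 h1 h2; rewrite [qP _ _ _ _ s]qP_rec.
have d1 := ne _ x0 h1; have d2 := ne _ x0 h2.
move: (1 - q * s / x) (1 - qpow logq lam * (q * s) / x) d1 d2 => A D A0 D0.
by rewrite [RHS]mulrA mulf_div [A * D]mulrC divff ?mulf_neq0 // mul1r.
Qed.

Variables (xi x : C).
Hypotheses (xi0 : xi != 0) (hx : off_spiral q xi x).

Lemma qP_geom_pos :
  geom_bounded (fun n => qP q logq lam x (q ^ n%:Z * xi)) 1.
Proof.
have [x0 xs] := hx.
have [K [K0 hK]] := mobius_growth (q * xi / x) (qpow logq lam * (q * xi) / x) q hq1.
apply: (geom_bounded_growth _ 1 (cmod q) K) => //; first exact: cmod_lt1.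
(* Close to 0 the factor [1 - a q s / x] cannot vanish, as [|a q s| < |x|]. *)
have : geometric (qpow logq lam * (q * xi)) q @ \oo --> (0 : C).
  apply: (cvg0_geometric _ _ (cmod_lt1 _ hq1)).
  exists (cmod (qpow logq lam * (q * xi))); near=> n.
  by rewrite /geometric [leLHS]cmodM cmodX.
move=> /cvgrPdist_lt/(_ `|x|) h; have {}h := h ltac:(by rewrite normr_gt0).
near=> n.
have hn : `|0 - geometric (qpow logq lam * (q * xi)) q n| < `|x| by near: n.
have e k : k * (q * xi) / x * q ^+ n = k * (q * (q ^ n%:Z * xi)) / x.
  by rewrite -exprnP; ring.
have qS : q ^ n.+1%:Z * xi = q * (q ^ n%:Z * xi) by rewrite intS expfzDr // mulrA.
rewrite qS qP_rec_inv //; last 2 first.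
- by rewrite -qS xs.
- apply/eqP => xE; move: hn; rewrite sub0r normrN /geometric /=.
  suff -> : qpow logq lam * (q * xi) * q ^+ n = x by rewrite ltxx.
  by rewrite xE -exprnP; move: (qpow _ _) => a; ring.
rewrite cmodM mul1r ler_wpM2r ?cmod_ge0 //.
have := e 1; rewrite !mul1r => <-; rewrite -e.
by near: n.
Unshelve. all: by end_near. Qed.

Lemma qP_geom_neg :
  geom_bounded (fun n => qP q logq lam x (q ^ (- n.+1%:Z) * xi))
    (cmod (qpow logq lam)).
Proof.
have [x0 xs] := hx.
pose a := qpow logq lam.
have a0 : a != 0 by exact: qpow_neq0.
have [K [K0 hK]] := mobius_growth (q * x / (a * xi)) (q * x / xi) q hq1.
apply: (geom_bounded_growth _ _ (cmod q) K) => //.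
- by rewrite cmod_gt0.
- exact: cmod_lt1.
near=> n.
pose s := q ^ (- n.+1%:Z) * xi.
have qs : q * (q ^ (- n.+2%:Z) * xi) = s.
  rewrite mulrA -[X in X * q ^ _]expr1z -expfzDr //; congr (q ^ _ * xi); lia.
have s0 : s != 0 by rewrite mulf_neq0 // expfz_neq0.
have xsn : x - s != 0 by rewrite subr_eq0 xs.
have qsx : s * q ^+ n.+1 = xi.
  by rewrite /s mulrAC exprnP -expfzDr // addNr mul1r.
rewrite [qP _ _ _ _ (q ^ (- n.+2%:Z) * xi)]qP_rec qs.
rewrite cmodM ler_wpM2r ?cmod_ge0 //.
(* At infinity the ratio is expanded in [1 / s], which is proportional to
   [q ^ n.+1]. *)
have -> : (1 - qpow logq lam * s / x) / (1 - s / x) =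
    a * ((1 - q * x / (a * xi) * q ^+ n) / (1 - q * x / xi * q ^+ n)).
  rewrite -qsx exprS /a; field.
  by rewrite expf_neq0 // hq0 s0 x0 xsn a0 -(opprB x) oppr_eq0 xsn.
by rewrite cmodM ler_wpM2l ?cmod_ge0 //; near: n.
Unshelve. all: by end_near. Qed.

End Kernel.

(** * Bilateral sums over the spiral *)

Section BilateralSums.
Context {R : realType}.
Local Notation C := (Cplx R).
Implicit Types (t u : int -> C).

Definition bisum t : C :=
  limn (series (fun n : nat => t n%:Z)) + limn (series (fun n : nat => t (- n.+1%:Z))).

Definition has_bisum t (l : C) : Prop := exists l1 l2 : C,
  [/\ series (fun n : nat => t n%:Z) @ \oo --> l1,
      series (fun n : nat => t (- n.+1%:Z)) @ \oo --> l2 & l = l1 + l2].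

Lemma has_bisumE t l : has_bisum t l -> bisum t = l.
Proof.
move=> [l1 [l2 [h1 h2 ->]]]; rewrite /bisum.
congr (_ + _).
- by apply: cvg_lim h1; exact: norm_hausdorff.
- by apply: cvg_lim h2; exact: norm_hausdorff.
Qed.

Lemma eq_has_bisum t u l : t =1 u -> has_bisum t l -> has_bisum u l.
Proof. by move=> /funext ->. Qed.

Lemma has_bisumD t u k l : has_bisum t k -> has_bisum u l ->
  has_bisum (fun n => t n + u n) (k + l).
Proof.
move=> [k1 [k2 [h1 h2 ->]]] [l1 [l2 [h3 h4 ->]]].
exists (k1 + l1), (k2 + l2); split; last by rewrite addrACA.
- rewrite seriesEnat; under eq_fun do rewrite big_split /=.
  by apply: cvgD; [exact: h1 | exact: h3].
- rewrite seriesEnat; under eq_fun do rewrite big_split /=.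
  by apply: cvgD; [exact: h2 | exact: h4].
Qed.

Lemma has_bisumZ (a : C) t l : has_bisum t l -> has_bisum (fun n => a * t n) (a * l).
Proof.
move=> [l1 [l2 [h1 h2 ->]]].
exists (a * l1), (a * l2); split; last by rewrite mulrDr.
- rewrite seriesEnat; under eq_fun do rewrite -mulr_sumr.
  by apply: cvgM; [exact: cvg_cst | exact: h1].
- rewrite seriesEnat; under eq_fun do rewrite -mulr_sumr.
  by apply: cvgM; [exact: cvg_cst | exact: h2].
Qed.

Lemma has_bisum_sum (I : Type) (r : seq I) (t : I -> int -> C) (l : I -> C) :
  (forall i, has_bisum (t i) (l i)) ->
  has_bisum (fun n => \sum_(i <- r) t i n) (\sum_(i <- r) l i).
Proof.
move=> h; elim: r => [|i r IH].
  rewrite big_nil; exists 0, 0; split; last by rewrite addr0.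
  - apply: cvg_near_cst; apply: nearW => n.
    by rewrite /series /= big1 // => k _; rewrite big_nil.
  - apply: cvg_near_cst; apply: nearW => n.
    by rewrite /series /= big1 // => k _; rewrite big_nil.
rewrite big_cons; apply: eq_has_bisum (has_bisumD _ _ _ _ (h i) IH) => n.
by rewrite big_cons.
Qed.

(** The partial sums over [n >= 0] and [n < 0] tend to [- t 0] and [t 0]. *)
Lemma has_bisum_telescope t : t n%:Z @[n --> \oo] --> (0 : C) ->
  t (- n.+1%:Z) @[n --> \oo] --> (0 : C) -> has_bisum (fun n => t (n + 1) - t n) 0.
Proof.
move=> h1 h2; exists (- t 0), (t 0); split; last by rewrite addNr.
- have -> : series (fun n : nat => t (n%:Z + 1) - t n%:Z) =
      (fun n : nat => t n%:Z - t 0).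
    apply/funext; elim=> [|n IH]; first by rewrite /series /= big_geq // subrr.
    by rewrite seriesSr IH -PoszD addn1 addrC addrA subrK.
  by rewrite -[X in _ --> X]add0r; apply: cvgB; [exact: h1 | exact: cvg_cst].
- have -> : series (fun n : nat => t (- n.+1%:Z + 1) - t (- n.+1%:Z)) =
      (fun n : nat => t 0 - t (- n%:Z)).
    apply/funext; elim=> [|n IH]; first by rewrite /series /= big_geq // oppr0 subrr.
    rewrite seriesSr IH addrA; congr (_ - _).
    by rewrite (_ : - n.+1%:Z + 1 = - n%:Z) ?subrK //; lia.
  rewrite -[X in _ --> X]subr0; apply: cvgB; first exact: cvg_cst.
  by rewrite -cvg_shiftS.
Qed.

Definition bigeom t : Prop :=
  (exists2 r, 0 <= r < 1 & geom_bounded (fun n => t n%:Z) r) /\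
  (exists2 r, 0 <= r < 1 & geom_bounded (fun n => t (- n.+1%:Z)) r).

Lemma bigeom_has_bisum t : bigeom t -> has_bisum t (bisum t).
Proof.
move=> [[r1 hr1 h1] [r2 hr2 h2]].
exists (limn (series (fun n : nat => t n%:Z))),
  (limn (series (fun n : nat => t (- n.+1%:Z)))); split => //.
- exact: series_cvg_geometric h1.
- exact: series_cvg_geometric h2.
Qed.

Lemma bigeom_telescope t : bigeom t -> has_bisum (fun n => t (n + 1) - t n) 0.
Proof.
move=> [[r1 hr1 h1] [r2 hr2 h2]]; apply: has_bisum_telescope.
- exact: cvg0_geometric h1.
- exact: cvg0_geometric h2.
Qed.

Lemma bigeom_bounded t u :
  geom_bounded (fun n => t n%:Z) 1 -> geom_bounded (fun n => t (- n.+1%:Z)) 1 ->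
  bigeom u -> bigeom (fun n => t n * u n).
Proof.
move=> t1 t2 [[r1 hr1 h1] [r2 hr2 h2]]; split.
- by exists r1 => //; rewrite -[r1]mul1r; exact: geom_boundedM t1 h1.
- by exists r2 => //; rewrite -[r2]mul1r; exact: geom_boundedM t2 h2.
Qed.

End BilateralSums.

Section Spiral.
Context {R : realType}.
Local Notation C := (Cplx R).
Variables (q xi : C).

Lemma powR_lt1 (r e : R) : 0 < r -> r < 1 -> 0 < e -> r `^ e < 1.
Proof.
move=> r0 r1 e0; have -> : 1 = 1 `^ e :> R by rewrite powR1.
by rewrite gt0_ltr_powR // nnegrE ?ltW.
Qed.

Lemma powR_exprAC (r e : R) n : 0 <= r -> (r ^+ n) `^ e = (r `^ e) ^+ n.
Proof.
move=> r0; rewrite -(powR_mulrn n r0) -(powR_mulrn n (powR_ge0 r e)).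
by rewrite -!powRrM mulrC.
Qed.

Lemma spiral_pos_geom (y : int -> C) (K e : R) (M : int) :
  (forall n, M <= n -> cmod (y n) <= K * cmod (q ^ n * xi) `^ e) ->
  geom_bounded (fun n => y n%:Z) (cmod q `^ e).
Proof.
move=> h; exists (K * cmod xi `^ e); exists `|M|%N => // n /= hn.
apply: le_trans (h _ _) _; first by lia.
rewrite -exprnP cmodM cmodX powRM ?exprn_ge0 ?cmod_ge0 // powR_exprAC ?cmod_ge0 //.
by rewrite [_ ^+ n * _]mulrC mulrA.
Qed.

Lemma spiral_neg_geom (y : int -> C) (K e : R) (M : int) :
  (forall n, n <= M -> cmod (y n) <= K * cmod (q ^ n * xi) `^ e) ->
  geom_bounded (fun n => y (- n.+1%:Z)) (cmod q `^ (- e)).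
Proof.
move=> h; exists (K * (cmod (xi / q) `^ e)); exists `|M|%N => // n /= hn.
apply: le_trans (h _ _) _; first by lia.
have -> : q ^ (- n.+1%:Z) * xi = q^-1 ^+ n * (xi / q).
  by rewrite -exprnN exprS invfM -exprVn -mulrA mulrCA [xi / q]mulrC.
rewrite [cmod (_ ^+ _ * _)]cmodM cmodX powRM ?exprn_ge0 ?cmod_ge0 //.
rewrite powR_exprAC ?cmod_ge0 //.
rewrite cmodV -powR_inv1 ?cmod_ge0 // -powRrM mulN1r.
by rewrite [_ ^+ n * _]mulrC mulrA.
Qed.

Hypotheses (hq0 : q != 0) (hq1 : `|q| < 1) (hxi0 : xi != 0).

(** The factor [s] of the Jackson measure compensates the denominator [s - b] at
    both ends of the spiral, also when [b = 0]. *)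
Lemma spiral_ratio_bounded (b : C) : (forall n : int, q ^ n * xi != b) ->
  geom_bounded (fun n => q ^ n%:Z * xi / (q ^ n%:Z * xi - b)) 1 /\
  geom_bounded (fun n => q ^ (- n.+1%:Z) * xi / (q ^ (- n.+1%:Z) * xi - b)) 1.
Proof.
move=> hb; split; last first.
  have := mobius_bounded 0 (b * q / xi) _ hq1; congr geom_bounded.
  apply/funext => n; set s := q ^ (- n.+1%:Z) * xi.
  have qsx : s * q ^+ n.+1 = xi.
    by rewrite /s mulrAC exprnP -expfzDr // addNr mul1r.
  have s0 : s != 0 by rewrite mulf_neq0 // expfz_neq0.
  have sb : s - b != 0 by rewrite subr_eq0 hb.
  rewrite -qsx exprS; field.
  by rewrite sb expf_neq0 // hq0 s0.
have [->|b0] := eqVneq b 0.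
  exists 1; apply: nearW => n; rewrite subr0 divff ?cmod1 ?expr1n ?mulr1 //.
  by rewrite mulf_neq0 // expfz_neq0.
have h : geom_bounded (fun n => - (xi / b) * q ^+ n) 1.
  exists (cmod (xi / b)); apply: nearW => n.
  rewrite [leLHS]cmodM cmodN cmodX expr1n ler_wpM2l ?cmod_ge0 //.
  have /andP[? /ltW ?] := cmod_lt1 _ hq1.
  by rewrite exprn_ile1.
have := geom_boundedM _ _ _ _ h (mobius_bounded 0 (xi / b) _ hq1).
rewrite mulr1; congr geom_bounded.
apply/funext => n; rewrite -exprnP.
have sb : q ^+ n * xi - b != 0 by rewrite subr_eq0 exprnP hb.
field.
by rewrite sb b0 -oppr_eq0 opprB [xi * _]mulrC sb.
Qed.

End Spiral.

(** * The convolution and its transform *)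

Section ConvolutionAlgebra.
Context {R : realType}.
Local Notation C := (Cplx R).

Lemma ext0_0 {T : Type} {N : nat} (a0 : T) (a : 'I_N -> T) : ext0 a0 a ord0 = a0.
Proof. by rewrite /ext0 unlift_none. Qed.

Lemma ext0_lift {T : Type} {N : nat} (a0 : T) (a : 'I_N -> T) i :
  ext0 a0 a (lift ord0 i) = a i.
Proof. by rewrite /ext0 liftK. Qed.

(** Partial fractions: [s / (s - b_i) = 1 - 1 / (1 - s / b_i)], and by the
    choice of [B_0] the constant terms add up to [I - B_oo]. *)
Lemma conv_B_coef {m N : nat} (b : 'I_N -> C) (Binf : 'M[C]_m) (B : 'I_N -> 'M[C]_m)
    (s : C) : s != 0 -> (forall i, b i != 0) -> (forall i, s != b i) ->
  \sum_(l < N.+1) (s / (s - ext0 0 b l)) *: conv_B Binf B l =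
  1%:M - qdiff_coef b Binf B s.
Proof.
move=> s0 b0 sb; rewrite big_ord_recl /conv_B !ext0_0 subr0 divff // scale1r.
have -> : \sum_(i < N) (s / (s - ext0 0 b (lift ord0 i))) *:
      ext0 (1%:M - Binf - \sum_(i < N) B i) B (lift ord0 i) =
    \sum_(i < N) B i - \sum_(i < N) (1 - s / b i)^-1 *: B i.
  rewrite -sumrB; apply: eq_bigr => i _.
  rewrite !ext0_lift -[X in _ = X - _]scale1r -scalerBl; congr (_ *: _).
  have sbi : s - b i != 0 by rewrite subr_eq0.
  by field; rewrite sbi b0 -oppr_eq0 opprB sbi.
by rewrite /qdiff_coef addrA subrK opprD addrA.
Qed.

(** Blockwise form of the convolution system.  The coefficient 0 attached to the
    block 0 expresses that no matrix [F_i] has a nonzero block row there. *)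
Lemma convolution_mul {m N : nat} (logq : C) (lam : R) (b : 'I_N -> C)
    (Binf : 'M[C]_m) (B : 'I_N -> 'M[C]_m) (x : C) (V : 'I_N.+1 -> 'cV[C]_m) :
  qdiff_coef b (conv_Finf Binf B) (conv_F logq lam Binf B) x *m \mxcol_k V k =
  \mxcol_k (let S := \sum_l conv_B Binf B l *m V l in
    V k - S + ext0 0 (fun i => (1 - x / b i)^-1) k *:
      (S - (1 - qpow logq lam) *: V k)).
Proof.
rewrite /qdiff_coef mulmxDl mulmx_suml /conv_Finf mulmxBl mul1mx mul_mxblock_mxrow.
apply/mxcolP => k.
rewrite submxcolD submxcolB submxcol_sum !mxcolK /=; congr (_ + _).
have blk i : submxcol (((1 - x / b i)^-1 *: conv_F logq lam Binf B i) *m \mxcol_k0 V k0) k =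
   if k == lift ord0 i then (1 - x / b i)^-1 *:
     (\sum_l conv_B Binf B l *m V l - (1 - qpow logq lam) *: V k) else 0.
  rewrite -scalemxAl /conv_F mul_mxblock_mxrow.
  have -> (c : C) (A : 'cV[C]_(\sum_(j < N.+1) m)) :
    submxcol (c *: A) k = c *: submxcol A k by apply/matrixP => ? ?; rewrite !mxE.
  rewrite mxcolK; case: eqP => [->|_]; last first.
    by rewrite big1 ?scaler0 // => j _; rewrite mul0mx.
  congr (_ *: _).
  rewrite (bigD1 (lift ord0 i)) //= eqxx [in RHS](bigD1 (lift ord0 i)) //=.
  rewrite mulmxBl mul_scalar_mx -!addrA; congr (_ + _); rewrite addrC.
  by congr (_ - _); apply: eq_bigr => j /negPf ->.
under eq_bigr => i _ do rewrite blk.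
case: (unliftP ord0 k) => [i ->|->].
  rewrite ext0_lift (bigD1 i) //= eqxx [X in _ + X = _]big1 ?addr0 // => j ji.
  by rewrite (inj_eq lift_inj) eq_sym (negPf ji).
by rewrite ext0_0 scale0r big1 // => i _; rewrite eq_sym; case: eqP.
Qed.

End ConvolutionAlgebra.

Section Transform.
Context {R : realType}.
Local Notation C := (Cplx R).
Variables (m N : nat) (q logq : C) (lam : R) (xi : C).
Variables (b : 'I_N -> C) (Binf : 'M[C]_m) (B : 'I_N -> 'M[C]_m).
Variables (D : set C) (Y : C -> 'cV[C]_m).
Hypotheses (hq0 : q != 0) (hq1 : `|q| < 1) (hlogq : cexp logq = q).
Hypotheses (hxi0 : xi != 0) (hb0 : forall i, b i != 0).
Hypothesis hxib : forall (n : int) (i : 'I_N), q ^ n * xi != b i.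
Hypothesis hD : forall n : int, D (q ^ n * xi).
Hypothesis hY : qdiff_solution q b Binf B D Y.
Hypothesis ha : exists (e1 C1 : R) (M1 : int), [/\ 0 < e1, 0 < C1 &
  forall n : int, M1 <= n -> forall k : 'I_m,
    cmod (Y (q ^ n * xi) k ord0) <= C1 * cmod (q ^ n * xi) `^ e1].
Hypothesis hb : exists (e2 C2 : R) (M2 : int), [/\ 0 < e2, 0 < C2 &
  forall n : int, n <= M2 -> forall k : 'I_m,
    cmod (Y (q ^ n * xi) k ord0) <= C2 * cmod (q ^ n * xi) `^ (lam - e2)].

Let s (n : int) : C := q ^ n * xi.
Let s_neq0 n : s n != 0. Proof. by rewrite mulf_neq0 // expfz_neq0. Qed.
Let sS n : s (n + 1) = q * s n.
Proof. by rewrite /s expfzDr // expr1z mulrAC mulrC mulrA. Qed.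

Lemma off_spiralM x : off_spiral q xi x -> off_spiral q xi (q * x).
Proof.
move=> [x0 xs]; split; first by rewrite mulf_neq0.
move=> n; rewrite -[n](subrK 1) -[q ^ _ * xi]/(s _) sS.
by rewrite (inj_eq (mulfI hq0)); exact: xs.
Qed.

(** At infinity the rate [|q| ^ lambda] of the kernel turns the rate
    [|q| ^ (e2 - lambda)] of [Y] into [|q| ^ e2]. *)
Lemma kernel_Y_bigeom x (k : 'I_m) : off_spiral q xi x ->
  bigeom (fun n => qP q logq lam x (s n) * Y (s n) k ord0).
Proof.
move=> hx; have /andP[r0 r1] := cmod_lt1 _ hq1.
have rgt0 : 0 < cmod q by rewrite cmod_gt0.
split.
- have [e1 [C1 [M1 [e0 _ h]]]] := ha.
  exists (cmod q `^ e1); first by rewrite powR_ge0 powR_lt1.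
  rewrite -[_ `^ _]mul1r; apply: geom_boundedM; first exact: qP_geom_pos.
  by apply: (spiral_pos_geom q xi (fun n => Y (s n) k ord0) C1 e1 M1) => n /h.
- have [e2 [C2 [M2 [e0 _ h]]]] := hb.
  exists (cmod q `^ e2); first by rewrite powR_ge0 powR_lt1.
  have -> : cmod q `^ e2 = cmod (qpow logq lam) * cmod q `^ (- (lam - e2)).
    rewrite cmod_qpow hlogq -powRD ?(gt_eqF rgt0) ?implybT //.
    by congr (_ `^ _); ring.
  apply: geom_boundedM; first exact: qP_geom_neg.
  by apply: (spiral_neg_geom q xi (fun n => Y (s n) k ord0) C2 _ M2) => // n /h.
Qed.

Let term (i : 'I_N.+1) (k : 'I_m) x : int -> C :=
  jackson_term q xi (Yhat_integrand q logq lam b Y i k x).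

Lemma term_bigeom x i k : off_spiral q xi x -> bigeom (term i k x).
Proof.
move=> hx.
have sb n : s n != ext0 0 b i.
  case: (unliftP ord0 i) => [j ->|->]; first by rewrite ext0_lift; exact: hxib.
  by rewrite ext0_0; exact: s_neq0.
have [h1 h2] := spiral_ratio_bounded q xi hq0 hq1 hxi0 _ sb.
have := bigeom_bounded (fun n => s n / (s n - ext0 0 b i)) _ h1 h2 (kernel_Y_bigeom x k hx).
congr bigeom; apply/funext => n.
by rewrite /term /jackson_term /Yhat_integrand -/(s n); ring.
Qed.

(** This is where the equation satisfied by [Y] enters. *)
Lemma sum_conv_B_term x k n :
  \sum_l \sum_j conv_B Binf B l k j * term l j x n =
  qP q logq lam x (s n) * (Y (s n) k ord0 - Y (s (n + 1)) k ord0).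
Proof.
have : (\sum_l (s n / (s n - ext0 0 b l)) *: conv_B Binf B l) *m Y (s n) =
    Y (s n) - Y (s (n + 1)).
  rewrite conv_B_coef //; last by move=> i; exact: hxib.
  by rewrite mulmxBl mul1mx sS hY //; [exact: hD | move=> i; exact: hxib].
move=> /matrixP/(_ k ord0); rewrite !mxE => <-.
under [in RHS]eq_bigr => j _ do rewrite summxE mulr_suml.
rewrite exchange_big /= mulr_sumr; apply: eq_bigr => l _.
rewrite mulr_sumr; apply: eq_bigr => j _.
by rewrite mxE /term /jackson_term /Yhat_integrand -/(s n); ring.
Qed.

Lemma qP_dilate x t : x != 0 -> qP q logq lam (q * x) t =
  (1 - qpow logq lam * t / x) / (1 - t / x) * qP q logq lam x t.
Proof.
move=> x0; have <- : q * (t / q) = t by rewrite mulrC divfK.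
by rewrite qP_scale // qP_rec.
Qed.

(** The functional equation at the level of summands, up to the difference of
    [U], which telescopes.  With [P = p (Y(s) - Y(q s)) + U (n + 1) - U n], equal
    to [(p - p') Y(s)], it reads
    [p' s / (s - b_i) Y = p s / (s - b_i) Y - P + c (P - (1 - a) p s / (s - b_i) Y)],
    a rational identity once [p'] is expressed through [p]. *)
Lemma term_dilate x i k n : off_spiral q xi x -> (forall i, x != b i) ->
  let c := ext0 0 (fun i => (1 - x / b i)^-1) i in
  let U n := qP q logq lam (q * x) (s n) * Y (s n) k ord0 in
  term i k (q * x) n = (1 - c * (1 - qpow logq lam)) * term i k x n +
   (c - 1) * (\sum_l \sum_j conv_B Binf B l k j * term l j x n) +
   (c - 1) * (U (n + 1) - U n).
Proof.
move=> [x0 xs] xb c U; rewrite sum_conv_B_term.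
rewrite /U /term /jackson_term /Yhat_integrand -/(s n) sS qP_scale // -sS qP_dilate //.
have xsn : x - s n != 0 by rewrite subr_eq0 xs.
move: (Y (s (n + 1)) k ord0) (Y (s n) k ord0) (qP _ _ _ _ _) (qpow _ _) => y' y p a.
rewrite /c; case: (unliftP ord0 i) => [j ->|->].
  have sb : s n - b j != 0 by rewrite subr_eq0 hxib.
  have xbj : x - b j != 0 by rewrite subr_eq0 xb.
  have bx : b j - x != 0 by rewrite -oppr_eq0 opprB.
  by rewrite !ext0_lift; field; rewrite ?xsn ?sb ?xbj ?bx ?x0 ?hb0.
by rewrite !ext0_0 subr0; have := s_neq0 n => sn0; field; rewrite ?xsn ?x0 ?sn0.
Qed.

Lemma bisum_term_dilate x i k : off_spiral q xi x -> (forall i, x != b i) ->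
  let c := ext0 0 (fun i => (1 - x / b i)^-1) i in
  bisum (term i k (q * x)) = (1 - c * (1 - qpow logq lam)) * bisum (term i k x) +
   (c - 1) * \sum_l \sum_j conv_B Binf B l k j * bisum (term l j x).
Proof.
move=> hx xb c; rewrite -[RHS]addr0 -[X in _ = _ + X](mulr0 (c - 1)); apply: has_bisumE.
have ht l j := bigeom_has_bisum _ (term_bigeom x l j hx).
have hu := bigeom_telescope _ (kernel_Y_bigeom (q * x) k (off_spiralM _ hx)).
apply: eq_has_bisum; first by move=> n; rewrite (term_dilate _ _ _ _ hx xb).
apply: has_bisumD; last exact: has_bisumZ.
apply: has_bisumD; first exact: has_bisumZ.
apply/has_bisumZ/has_bisum_sum => l; apply: has_bisum_sum => j.
exact: has_bisumZ.
Qed.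

Lemma Yhat_jackson_cvg x i k : off_spiral q xi x ->
  jackson_cvg q xi (Yhat_integrand q logq lam b Y i k x).
Proof.
move=> hx; have [l1 [l2 [h1 h2 _]]] := bigeom_has_bisum _ (term_bigeom x i k hx).
by split; [exact: cvgP h1 | exact: cvgP h2].
Qed.

Lemma Yhat_blockE x i k :
  Yhat_block q logq lam xi b Y i x k ord0 = (1 - q) * bisum (term i k x).
Proof. by rewrite mxE. Qed.

Lemma Yhat_qdiff_solution :
  qdiff_solution q b (conv_Finf Binf B) (conv_F logq lam Binf B)
    (off_spiral q xi) (Yhat q logq lam xi b Y).
Proof.
move=> x hx xb; rewrite /Yhat convolution_mul; apply/eq_mxcolP => i /=.
apply/colP => k; rewrite Yhat_blockE bisum_term_dilate //.
have SE : (\sum_l conv_B Binf B l *m Yhat_block q logq lam xi b Y l x) k ord0 =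
    (1 - q) * \sum_l \sum_j conv_B Binf B l k j * bisum (term l j x).
  rewrite summxE mulr_sumr; apply: eq_bigr => l _.
  rewrite mxE mulr_sumr; apply: eq_bigr => j _.
  by rewrite Yhat_blockE mulrCA.
have entry (u v : 'cV[C]_m) (c d : C) :
    (u - v + c *: (v - d *: u)) k ord0 =
    u k ord0 - v k ord0 + c * (v k ord0 - d * u k ord0) by rewrite !mxE.
rewrite entry SE Yhat_blockE; ring.
Qed.

End Transform.

Theorem theorem2p6 (R : realType) (m N : nat)
    (q logq : Cplx R) (lam : R) (xi : Cplx R)
    (b : 'I_N -> Cplx R) (Binf : 'M[Cplx R]_m) (B : 'I_N -> 'M[Cplx R]_m)
    (D : set (Cplx R)) (Y : Cplx R -> 'cV[Cplx R]_m)
    (hq0 : q != 0) (hq1 : `|q| < 1) (hlogq : cexp logq = q)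
    (hxi0 : xi != 0)
    (hb_inj : injective b) (hb0 : forall i, b i != 0)
    (hxib : forall (n : int) (i : 'I_N), q ^ n * xi != b i)
    (hD : forall n : int, D (q ^ n * xi))
    (hY : qdiff_solution q b Binf B D Y)
    (ha : exists (e1 C1 : R) (M1 : int), [/\ 0 < e1, 0 < C1 &
       forall n : int, M1 <= n -> forall k : 'I_m,
         cmod (Y (q ^ n * xi) k ord0) <= C1 * cmod (q ^ n * xi) `^ e1])
    (hb : exists (e2 C2 : R) (M2 : int), [/\ 0 < e2, 0 < C2 &
       forall n : int, n <= M2 -> forall k : 'I_m,
         cmod (Y (q ^ n * xi) k ord0) <= C2 * cmod (q ^ n * xi) `^ (lam - e2)]) :
  (forall x : Cplx R, off_spiral q xi x ->
     forall (i : 'I_N.+1) (k : 'I_m),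
       jackson_cvg q xi (Yhat_integrand q logq lam b Y i k x))
  /\ qdiff_solution q b (conv_Finf Binf B) (conv_F logq lam Binf B)
       (off_spiral q xi) (Yhat q logq lam xi b Y).
Proof.
split=> [x hx i k|].
- exact: (Yhat_jackson_cvg _ _ _ _ _ _ _ _ hq0 hq1 hlogq hxi0 hxib ha hb).
- exact: (Yhat_qdiff_solution _ _ _ _ _ _ _ _ _ _ _ hq0 hq1 hlogq hxi0 hb0 hxib hD hY ha hb).
Qed.
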